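(* Let $k\in\{1,2,3\}$ and consider the local time-stepping (LTS) Runge-Kutta discontinuous Galerkin scheme of order $k+1$ described in the context, based on SSP-RK$(2,2)$ if $k=1$, on SSP-RK$(3,3)$ if $k=2$, and on SSP-RK$(5,4)$ if $k=3$, for the scalar conservation law $\partial_t u+\partial_x f(u)=0$ on $\mathbb{R}\times(0,T)$, $u(\cdot,0)=u_0$. Let $u_h^n\in V_h^k$ denote the numerical solution produced by the scheme at time $t^n$ (after limiting). Then the scheme conserves mass exactly: $$\int_{\mathbb{R}}u_h^{n+1}\,dx=\int_{\mathbb{R}}u_h^{n}\,dx,\qquad\forall\,n=0,\ldots,N-1.$$
   Context: **Space discretization.** $\mathbb{R}$ is partitioned into cells $I_j=(x_{j-1/2},x_{j+1/2})$, with midpoint $x_j$, $\Delta_j=x_{j+1/2}-x_{j-1/2}$, $h=\max_j\Delta_j$. $V_h^k=\{v\in L^1(\mathbb{R}): v|_{I_j}\in\mathcal{P}^k(I_j)\ \forall j\}$. With $P_l$ the Legendre polynomial of degree $l$ and $\varphi_j^{(l)}(x)=P_l(2(x-x_j)/\Delta_j)$, a function of $V_h^k$ is written $u_h|_{I_j}=\sum_{l=0}^k u_j^{(l)}\varphi_j^{(l)}$; $\boldsymbol{u}_j=(u_j^{(l)})_{0\le l\le k}$, and $u_j^{(0)}$ is the cell average. Traces: $u_{j+1/2}^-=\sum_{l}u_j^{(l)}$ and $u_{j-1/2}^+=\sum_l(-1)^lu_j^{(l)}$. The numerical flux $h(\cdot,\cdot)$ (same letter as the mesh size) is locally Lipschitz,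 consistent ($h(u,u)=f(u)$), nondecreasing in its first and nonincreasing in its second argument. The spatial operator is $$L_{h,j}^{(l)}(u_{j-1/2}^\pm,\boldsymbol{u}_j,u_{j+1/2}^\pm)=\frac{2l+1}{\Delta_j}\Big\{\int_{I_j}f(u_{j-1/2}^+,\boldsymbol{u}_j,u_{j+1/2}^-)\,\partial_x\varphi_j^{(l)}dx-\big[h(u_{j+1/2}^-,u_{j+1/2}^+)-(-1)^lh(u_{j-1/2}^-,u_{j-1/2}^+)\big]\Big\},$$ where the integral denotes a Gauss-Lobatto quadrature of $f(u_h)\,\partial_x\varphi_j^{(l)}$ using the values $u_{j-1/2}^+$, $u_{j+1/2}^-$ at the end points and the values of $\sum_l u_j^{(l)}\varphi_j^{(l)}$ at interior nodes. Initial data: $u_j^{(l)}(0)=\frac{2l+1}{\Delta_j}\int_{I_j}u_0\varphi_j^{(l)}dx$, then limited. **SSP-RK$(s,r)$** for $\frac{d}{dt}U=L(U)$: $U^{(0)}=U^n$, $U^{(i)}=\sum_{\nu=0}^{i-1}\big(\alpha_{i\nu}U^{(\nu)}+\beta_{i\nu}\Delta t\,L(U^{(\nu)})\big)$ for $i=1,\dots,s$, $U^{n+1}=U^{(s)}$. Coefficients (unlisted ones are $0$): - $(2,2)$: $\alpha_{10}=\beta_{10}=1$, $\alpha_{20}=\alpha_{21}=\beta_{21}=1/2$. - $(3,3)$: $\alpha_{10}=\beta_{10}=1$, $\alpha_{20}=3/4$, $\alpha_{21}=\beta_{21}=1/4$, $\alpha_{30}=1/3$, $\alpha_{32}=\beta_{32}=2/3$.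 - $(5,4)$: $\alpha_{10}=1$; $\alpha_{20}=0.261216512493821$, $\alpha_{21}=0.738783487506179$; $\alpha_{30}=0.623613752757655$, $\alpha_{32}=0.376386247242345$; $\alpha_{40}=0.444745181201454$, $\alpha_{41}=0.120932584902288$, $\alpha_{43}=0.434322233896258$; $\alpha_{50}=0.213357715199957$, $\alpha_{51}=0.209928473023448$, $\alpha_{52}=0.063353148180384$, $\alpha_{54}=0.513360663596212$; $\beta_{10}=0.605491839566400$; $\beta_{21}=0.447327372891397$; $\beta_{30}=0.000000844149769$, $\beta_{32}=0.227898801230261$; $\beta_{40}=0.002856233144485$, $\beta_{41}=0.073223693296006$, $\beta_{43}=0.262978568366434$; $\beta_{50}=0.002362549760441$, $\beta_{51}=0.127109977308333$, $\beta_{52}=0.038359814234063$, $\beta_{54}=0.310835692561898$. **Limiter.** $m(a_1,\dots,a_\nu)=\sigma\min_i|a_i|$ with $\sigma=\mathrm{sign}(a_1)$ if all $a_i$ have the same sign and $\sigma=0$ otherwise; $\widetilde m(a_1,\dots,a_\nu)=a_1$ if $|a_1|\le C_Mh^2$ (with $C_M>0$ constant, $h$ the mesh size), and $=m(a_1,\dots,a_\nu)$ otherwise. $\Lambda\Pi_h^1(u_h)|_{I_j}=u_j^{(0)}+\widetilde m(u_j^{(1)},u_{j+1}^{(0)}-u_j^{(0)},u_j^{(0)}-u_{j-1}^{(0)})\varphi_j^{(1)}$. For $k>1$, put $u_{j+1/2}^{-(\mathrm{mod})}=u_j^{(0)}+\widetilde m(u_{j+1/2}^--u_j^{(0)},u_{j+1}^{(0)}-u_j^{(0)},u_j^{(0)}-u_{j-1}^{(0)})$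 and $u_{j-1/2}^{+(\mathrm{mod})}=u_j^{(0)}-\widetilde m(u_j^{(0)}-u_{j-1/2}^+,u_{j+1}^{(0)}-u_j^{(0)},u_j^{(0)}-u_{j-1}^{(0)})$; then $\Lambda\Pi_h^k(u_h)|_{I_j}=u_h|_{I_j}$ if both modified traces equal the original ones, and $=\Lambda\Pi_h^1(u_h)|_{I_j}$ otherwise. Limited quantities are used throughout and the superscript (mod) is dropped below. **LTS scheme of order $k+1$.** Time levels $t^n=n\Delta t$, $\Delta t=T/N$, and an integer $M\ge1$ with $t^{n,p}=t^n+p\Delta t/M$. At each $n$ an interface point $x_{j_0+1/2}$, $j_0=j_0^n$, is given. Cells $j\le j_0$ are coarse (step $\Delta t$), cells $j\ge j_0+1$ are fine (step $\Delta t/M$). Given the solution at $t^n$, one step consists of the following. *Step 1 (prediction on $I_{j_0}$).* Compute the stages $\boldsymbol{u}_{j_0}^{n,(i)}$, $i=1,\dots,s-1$, of SSP-RK$(s,k+1)$ with step $\Delta t$ locally on $I_{j_0}$, i.e. with $L_{h,j_0}^{(l)}$ in which $u_{j_0-1/2}^{n,(i),-}$ is replaced by $u_{j_0-1/2}^{n,(i),+}$ and $u_{j_0+1/2}^{n,(i),+}$ by $u_{j_0+1/2}^{n,(i),-}$; $\boldsymbol{u}^{n,(0)}_{j_0}=\boldsymbol{u}^n_{j_0}$. For each component write $w^{(i)}=u_{j_0}^{(l),n,(i)}$ and $w^{p,(i)}=u_{j_0}^{(l),n,p,(i)}$, $p=0,\dots,M-1$. The predicted values are: - $k=1$: $w^{p,(0)}=(1-\frac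 pM)w^{(0)}+\frac pMw^{(1)}$, $w^{p,(1)}=(1-\frac{p+1}M)w^{(0)}+\frac{p+1}Mw^{(1)}$. - $k=2$: $w^{p,(i)}=(1-a_i-b_i)w^{(0)}+(a_i-b_i)w^{(1)}+2b_iw^{(2)}$, with $a_0=\frac pM$, $b_0=\frac{p^2}{M^2}$; $a_1=\frac{p+1}M$, $b_1=\frac{p(p+2)}{M^2}$; $a_2=\frac{2p+1}{2M}$, $b_2=\frac{2p^2+2p+1}{2M^2}$. - $k=3$: let $\gamma^{(0)}=0$, $\gamma^{(1)}=\beta_{10}$, $\gamma^{(2)}=\alpha_{21}\gamma^{(1)}+\beta_{21}$, $\gamma^{(3)}=\alpha_{32}\gamma^{(2)}+\beta_{32}+\beta_{30}$ and $D=(w^{(1)}-\alpha_{10}w^{(0)})/\beta_{10}$. Let $(X_1,Y_1)$ solve the pair of linear equations $w^{(2)}=\alpha_{20}w^{(0)}+\alpha_{21}w^{(1)}+\beta_{21}(D+\gamma^{(1)}X+\frac12(\gamma^{(1)})^2Y)$ and (E3): $w^{(3)}=\alpha_{30}w^{(0)}+\alpha_{32}w^{(2)}+\beta_{30}D+\beta_{32}(D+\gamma^{(2)}X+\frac12(\gamma^{(2)})^2Y)$. Let $(X_2,Y_2)$ solve (E3) together with $w^{(4)}=\alpha_{40}w^{(0)}+\alpha_{41}w^{(1)}+\alpha_{43}w^{(3)}+\beta_{40}D+\beta_{41}(D+\gamma^{(1)}X+\frac12(\gamma^{(1)})^2Y)+\beta_{43}(D+\gamma^{(3)}X+\frac12(\gamma^{(3)})^2Y)$.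 Set $X=(X_1+X_2)/2$, $Y=(Y_1+Y_2)/2$, $w^{p,(0)}=w^{(0)}+\frac pMD+\frac12(\frac pM)^2X+\frac16(\frac pM)^3Y$, and for $i=1,\dots,4$: $w^{p,(i)}=\sum_{\nu=0}^{i-1}\big[\alpha_{i\nu}w^{p,(\nu)}+\frac{\beta_{i\nu}}M(D+\tau_\nu X+\frac12\tau_\nu^2Y)\big]$, $\tau_\nu=(p+\gamma^{(\nu)})/M$. The predicted interface trace is $u_{j_0+1/2}^{n,p,(i),-}=\sum_{l}u_{j_0}^{(l),n,p,(i)}$. *Step 2a (coarse cells $j<j_0$).* For $i=1,\dots,s$: $u_j^{(l),n,(i)}=\sum_{\nu=0}^{i-1}\alpha_{i\nu}u_j^{(l),n,(\nu)}+\beta_{i\nu}\Delta t\,L_{h,j}^{(l)}(u_{j-1/2}^{n,(\nu),\pm},\boldsymbol{u}_j^{n,(\nu)},u_{j+1/2}^{n,(\nu),\pm})$, and $\boldsymbol{u}_j^{n+1}=\boldsymbol{u}_j^{n,(s)}$. The right trace $u_{j_0-1/2}^{n,(\nu),+}$ is that of $\boldsymbol{u}_{j_0}^{n,(\nu)}$ from Step 1. *Step 2b (fine cells $j>j_0$).* $\boldsymbol{u}_j^{n,0}=\boldsymbol{u}_j^n$. For $p=0,\dots,M-1$: $\boldsymbol{u}_j^{n,p,(0)}=\boldsymbol{u}_j^{n,p}$, and for $i=1,\dots,s$: $u_j^{(l),n,p,(i)}=\sum_{\nu=0}^{i-1}\alpha_{i\nu}u_j^{(l),n,p,(\nu)}+\beta_{i\nu}\frac{\Delta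 t}{M}L_{h,j}^{(l)}(u_{j-1/2}^{n,p,(\nu),\pm},\boldsymbol{u}_j^{n,p,(\nu)},u_{j+1/2}^{n,p,(\nu),\pm})$, where at $x_{j_0+1/2}$ the left trace is the predicted trace and the right trace comes from $I_{j_0+1}$. If $p<M-1$, after each stage the fine cell values are replaced by their $\Lambda\Pi_h^k$-limited values (using the predicted values in $I_{j_0}$ as left neighbour), and the predicted trace is replaced by $u_{j_0}^{(0),n,p,(i)}+\widetilde m\big(u_{j_0+1/2}^{n,p,(i),-}-u_{j_0}^{(0),n,p,(i)},\,u_{j_0+1}^{(0),n,p,(i)}-u_{j_0}^{(0),n,p,(i)},\,u_{j_0}^{(0),n,p,(i)}-u_{j_0-1}^{(0),n,(i)}\big)$. (For $i=s$, the predicted values on $I_{j_0}$ at $(p,s)$ mean those at $(p+1,0)$.) Set $\boldsymbol{u}_j^{n,p+1}=\boldsymbol{u}_j^{n,p,(s)}$, and $\boldsymbol{u}_j^{n+1}=\boldsymbol{u}_j^{n,M-1,(s)}$. *Step 3 (correction on $I_{j_0}$ and limiting).* $\widehat u_{j_0}^{(l),n,(0)}=u_{j_0}^{(l),n}$ and, for $i=1,\dots,s$, $$\widehat u_{j_0}^{(l),n,(i)}=\sum_{\nu=0}^{i-1}\alpha_{i\nu}\widehat u_{j_0}^{(l),n,(\nu)}+\beta_{i\nu}\frac{\Delta t}{M}\sum_{p=0}^{M-1}L_{h,j_0}^{(l)}\big(u_{j_0-1/2}^{n,(\nu),\pm},\boldsymbol{u}_{j_0}^{n,(\nu)},u_{j_0+1/2}^{n,p,(\nu),\pm}\big),$$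 where $\boldsymbol{u}_{j_0}^{n,(\nu)}$ are the Step 1 stage values and the traces at $x_{j_0-1/2}$ and at $x_{j_0+1/2}$ are the same as those used in Steps 2a and 2b respectively. Set $u_{j_0}^{(l),n+1}=\widehat u_{j_0}^{(l),n,(s)}$ and finally apply $\Lambda\Pi_h^k$ on all cells to obtain $u_h^{n+1}$.
   Formalization: Cell widths are assumed bounded below by a positive constant; for k=3 the (5,4) table is any one within 10^-15 of the printed decimals whose alpha rows sum to 1 (the printed last row sums to 1+10^-15), and the Gauss-Lobatto rule has an interior node. *)

(* Defs.v *)
From HB Require Import structures.
From mathcomp Require Import all_boot all_order all_algebra.
From mathcomp Require Import all_classical all_reals all_analysis.
Set Implicit Arguments.
Unset Strict Implicit.
Unset Printing Implicit Defensive.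
Import Order.TTheory GRing.Theory Num.Theory.
Import numFieldNormedType.Exports.
Local Open Scope classical_set_scope.
Local Open Scope ring_scope.

Section Mesh.
Variables (R : realType) (x : int -> R).
(* x j stands for x_{j+1/2}, so that I_j = ]x (j - 1), x j[ *)

Definition cell (j : int) : set R := `]x (j - 1), x j[.

Definition partitions_line : Prop :=
  (forall j, x (j - 1) < x j) /\
  (forall y, exists j, x (j - 1) <= y < x j).

Definition width (j : int) : R := x j - x (j - 1).

Definition midpoint (j : int) : R := (x (j - 1) + x j) / 2.

Definition mesh_size : R := sup (range width).

(* Rodrigues' formula *)
Definition legendre (l : nat) : {poly R} :=
  (2 ^+ l * l`!%:R)^-1 *: (('X ^+ 2 - 1) ^+ l)^`(l).

Definition phi (j : int) (l : nat) : {poly R} :=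
  legendre l \Po ((2 / width j) *: ('X - (midpoint j)%:P)).

Variable k : nat.

Definition Vh : set (R -> R) :=
  [set v | (@lebesgue_measure R).-integrable setT (EFin \o v) /\
    forall j, exists2 p : {poly R},
      (size p <= k.+1)%N & forall y, cell j y -> v y = p.[y] ].

(* The Legendre coefficients of a function of Vh are stored as U j l for
   l <= k; entries with l > k are irrelevant. *)
Definition cell_poly (j : int) (c : nat -> R) : {poly R} :=
  \sum_(l < k.+1) c l *: phi j l.

Definition has_coefs (v : R -> R) (U : int -> nat -> R) : Prop :=
  forall j y, cell j y -> v y = (cell_poly j (U j)).[y].

(* Traces of a cell: trace_r c is its u^- at the right end point, trace_l c
   its u^+ at the left one. *)
Definition trace_r (c : nat -> R) : R := \sum_(l < k.+1) c l.
Definition trace_l (c : nat -> R) : R := \sum_(l < k.+1) (-1) ^+ l * c l.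

Definition projection (u0 : R -> R) : int -> nat -> R := fun j l =>
  (2 * l + 1)%:R / width j *
  \int[@lebesgue_measure R]_(y in cell j) (u0 y * (phi j l).[y]).

End Mesh.

Section Flux.
Variable R : realType.

Definition locally_lipschitz2 (g : R -> R -> R) : Prop :=
  forall z : R * R, exists2 V : set (R * R),
    nbhs z V & [lipschitz g u.1 u.2 | u in V].

Definition numerical_flux (f : R -> R) (g : R -> R -> R) : Prop :=
  [/\ locally_lipschitz2 g,
      forall u, g u u = f u,
      forall b, {homo (g^~ b) : a a' / a <= a'} &
      forall a, {homo (g a) : b b' /~ b <= b'}].

(* Gauss-Lobatto rule on [-1, 1]: the two end points and q interior nodes,
   exact up to degree 2 (q + 2) - 3. *)
Definition gauss_lobatto (q : nat) (xi om : 'I_q.+2 -> R) : Prop :=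
  [/\ xi ord0 = -1, xi ord_max = 1,
      {homo xi : i i' / (i < i')%N >-> i < i'} &
      forall p : {poly R}, (size p <= (2 * q).+2)%N ->
        \sum_i om i * p.[xi i] =
        \int[@lebesgue_measure R]_(y in `[-1, 1]) p.[y] ].

End Flux.

Section Operator.
Variables (R : realType) (k : nat) (x : int -> R).
Variables (f : R -> R) (g : R -> R -> R).
Variables (q : nat) (xi om : 'I_q.+2 -> R).

(* Affine image of the reference node xi i in I_j *)
Definition node (j : int) (i : 'I_q.+2) : R :=
  midpoint x j + width x j / 2 * xi i.

Definition node_value (j : int) (up : R) (c : nat -> R) (um : R)
    (i : 'I_q.+2) : R :=
  if i == ord0 then up
  else if i == ord_max then um
  else (cell_poly x k j c).[node j i].

(* lm, lp are u^-, u^+ at x_{j-1/2}; rm, rp are u^-, u^+ at x_{j+1/2}. *)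
Definition Lh (j : int) (l : nat) (lm lp : R) (c : nat -> R) (rm rp : R) : R :=
  (2 * l + 1)%:R / width x j *
  (width x j / 2 *
     (\sum_i om i * (f (node_value j lp c rm i) * ((phi x j l)^`()).[node j i]))
   - (g rm rp - (-1) ^+ l * g lm lp)).

End Operator.

Section RungeKutta.
Variable R : realType.

Definition tab (t : seq (seq R)) : nat -> nat -> R :=
  fun i nu => nth 0 (nth [::] t i) nu.

(* Decimal fraction from five groups of three digits:
   dec 261 216 512 493 821 is 0.261216512493821. *)
Definition dec (d1 d2 d3 d4 d5 : nat) : R :=
  foldr (fun (d : nat) y => (d%:R + y) / 1000) 0 [:: d1; d2; d3; d4; d5].

Definition rk22_alpha := tab [:: [::]; [:: 1]; [:: 1 / 2; 1 / 2]].
Definition rk22_beta := tab [:: [::]; [:: 1]; [:: 0; 1 / 2]].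

Definition rk33_alpha :=
  tab [:: [::]; [:: 1]; [:: 3 / 4; 1 / 4]; [:: 1 / 3; 0; 2 / 3]].
Definition rk33_beta :=
  tab [:: [::]; [:: 1]; [:: 0; 1 / 4]; [:: 0; 0; 2 / 3]].

Definition rk54_alpha := tab
  [:: [::];
      [:: 1];
      [:: dec 261 216 512 493 821; dec 738 783 487 506 179];
      [:: dec 623 613 752 757 655; 0;
          dec 376 386 247 242 345];
      [:: dec 444 745 181 201 454; dec 120 932 584 902 288;
          0; dec 434 322 233 896 258];
      [:: dec 213 357 715 199 957; dec 209 928 473 023 448;
          dec 063 353 148 180 384; 0;
          dec 513 360 663 596 212]].
Definition rk54_beta := tab
  [:: [::];
      [:: dec 605 491 839 566 400];
      [:: 0; dec 447 327 372 891 397];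
      [:: dec 000 000 844 149 769; 0;
          dec 227 898 801 230 261];
      [:: dec 002 856 233 144 485; dec 073 223 693 296 006;
          0; dec 262 978 568 366 434];
      [:: dec 002 362 549 760 441; dec 127 109 977 308 333;
          dec 038 359 814 234 063; 0;
          dec 310 835 692 561 898]].

(* c agrees with the printed 15-digit table t up to one unit in the last
   place, unlisted entries being exactly 0. *)
Definition rounds_to (t c : nat -> nat -> R) : Prop :=
  forall i nu, if t i nu == 0 then c i nu = 0
               else `|c i nu - t i nu| <= (10 ^+ 15)^-1.

(* The printed (5,4) decimals are rounded: the last alpha row adds up to
   1 + 10^-15, whereas alpha rows of a Runge-Kutta scheme in this form must
   add up to 1. They are therefore read as roundings of a consistent table. *)
Definition ssp_rk (k : nat) (a b : nat -> nat -> R) : Prop :=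
  match k with
  | 1 => a = rk22_alpha /\ b = rk22_beta
  | 2 => a = rk33_alpha /\ b = rk33_beta
  | 3 => [/\ rounds_to rk54_alpha a, rounds_to rk54_beta b &
             forall i, (1 <= i <= 5)%N -> \sum_(nu < i) a i nu = 1]
  | _ => False
  end.

Definition stages (k : nat) : nat :=
  match k with 1 => 2 | 2 => 3 | _ => 5 end.

(* Stage i from the previous stages y and their slopes dy, with step tau *)
Definition rk_stage (a b : nat -> nat -> R) (tau : R) (i : nat)
    (y dy : nat -> R) : R :=
  \sum_(nu < i) (a i nu * y nu + b i nu * tau * dy nu).

End RungeKutta.

Section Limiter.
Variables (R : realType) (k : nat) (x : int -> R) (CM : R).

Definition minmod (a : R) (s : seq R) : R :=
  if all (fun c => Num.sg c == Num.sg a) s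
  then Num.sg a * \big[Num.min/`|a|]_(c <- s) `|c| else 0.

Definition minmodTVB (a : R) (s : seq R) : R :=
  if `|a| <= CM * mesh_size x ^+ 2 then a else minmod a s.

Definition jumps (U : int -> nat -> R) (j : int) : seq R :=
  [:: U (j + 1) 0%N - U j 0%N; U j 0%N - U (j - 1) 0%N].

Definition limit1 (U : int -> nat -> R) (j : int) (l : nat) : R :=
  match l with
  | 0 => U j 0%N
  | 1 => minmodTVB (U j 1%N) (jumps U j)
  | _ => 0
  end.

Definition trace_r_mod (U : int -> nat -> R) (j : int) : R :=
  U j 0%N + minmodTVB (trace_r k (U j) - U j 0%N) (jumps U j).

Definition trace_l_mod (U : int -> nat -> R) (j : int) : R :=
  U j 0%N - minmodTVB (U j 0%N - trace_l k (U j)) (jumps U j).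

Definition limit (U : int -> nat -> R) (j : int) : nat -> R :=
  if [&& (1 < k)%N, trace_r_mod U j == trace_r k (U j)
      & trace_l_mod U j == trace_l k (U j)]
  then U j else limit1 U j.

End Limiter.

Section Prediction.
Variables (R : realType) (a b : nat -> nat -> R) (M : nat).

(* w i: one component of the local stage i; wp p i: its prediction at (p, i) *)

Definition predict1 (w : nat -> R) (wp : nat -> nat -> R) : Prop :=
  forall p, (p < M)%N ->
    wp p 0%N = (1 - p%:R / M%:R) * w 0%N + p%:R / M%:R * w 1%N /\
    wp p 1%N = (1 - p.+1%:R / M%:R) * w 0%N + p.+1%:R / M%:R * w 1%N.

Definition interp2 (w : nat -> R) (c d : R) : R :=
  (1 - c - d) * w 0%N + (c - d) * w 1%N + 2 * d * w 2%N.

Definition predict2 (w : nat -> R) (wp : nat -> nat -> R) : Prop :=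
  forall p, (p < M)%N ->
    [/\ wp p 0%N = interp2 w (p%:R / M%:R) ((p ^ 2)%:R / M%:R ^+ 2),
        wp p 1%N = interp2 w (p.+1%:R / M%:R) ((p * (p + 2))%:R / M%:R ^+ 2) &
        wp p 2%N = interp2 w ((2 * p + 1)%:R / (2 * M%:R))
                             ((2 * p ^ 2 + 2 * p + 1)%:R / (2 * M%:R ^+ 2))].

Definition gam (i : nat) : R :=
  let g1 := b 1%N 0%N in
  let g2 := a 2%N 1%N * g1 + b 2%N 1%N in
  match i with
  | 0 => 0
  | 1 => g1
  | 2 => g2
  | _ => a 3%N 2%N * g2 + b 3%N 2%N + b 3%N 0%N
  end.

(* First derivative at time t, from the derivatives D, X, Y at time 0 *)
Definition slope (D X Y t : R) : R := D + t * X + t ^+ 2 / 2 * Y.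

Definition predict3 (w : nat -> R) (wp : nat -> nat -> R) : Prop :=
  let D := (w 1%N - a 1%N 0%N * w 0%N) / b 1%N 0%N in
  let E2 X Y := w 2%N = a 2%N 0%N * w 0%N + a 2%N 1%N * w 1%N
                        + b 2%N 1%N * slope D X Y (gam 1) in
  let E3 X Y := w 3%N = a 3%N 0%N * w 0%N + a 3%N 2%N * w 2%N
                        + b 3%N 0%N * D + b 3%N 2%N * slope D X Y (gam 2) in
  let E4 X Y := w 4%N = a 4%N 0%N * w 0%N + a 4%N 1%N * w 1%N
                        + a 4%N 3%N * w 3%N + b 4%N 0%N * D
                        + b 4%N 1%N * slope D X Y (gam 1)
                        + b 4%N 3%N * slope D X Y (gam 3) in
  exists X1 Y1 X2 Y2 : R,
    [/\ E2 X1 Y1, E3 X1 Y1, E3 X2 Y2, E4 X2 Y2 &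
      let X := (X1 + X2) / 2 in
      let Y := (Y1 + Y2) / 2 in
      forall p, (p < M)%N ->
        let th := p%:R / M%:R in
        wp p 0%N = w 0%N + th * D + th ^+ 2 / 2 * X + th ^+ 3 / 6 * Y /\
        forall i, (1 <= i <= 4)%N ->
          wp p i = rk_stage a b M%:R^-1 i (wp p)
                     (fun nu => slope D X Y ((p%:R + gam nu) / M%:R))].

Definition predict (k : nat) : (nat -> R) -> (nat -> nat -> R) -> Prop :=
  match k with 1 => predict1 | 2 => predict2 | _ => predict3 end.

End Prediction.

Section LocalTimeStepping.
Variables (R : realType) (k : nat) (x : int -> R).
Variables (f : R -> R) (g : R -> R -> R).
Variables (q : nat) (xi om : 'I_q.+2 -> R).
Variables (a b : nat -> nat -> R) (CM dt : R) (M : nat) (j0 : int).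

Let s := stages k.
Let tr := @trace_r R k.
Let tl := @trace_l R k.
Let L := Lh k x f g xi om.
Let tau := dt / M%:R.

(* Arrays of the intermediate quantities of one step, starting from U:
     V i j l    coarse stage i, cells j <= j0 (for j = j0 the local stages,
                only i < s is used);
     P p i l    predicted values on I_{j0}, p < M, i < s;
     t p i      left trace at x_{j0+1/2} used at (p, i), p < M, i < s;
     Z p i j l  fine stage, j > j0, p < M, before limiting;
     W p i j l  fine stage, j > j0, p < M, as used by the scheme;
     C i l      corrected stage i on I_{j0}. *)

Definition local_stages (U : int -> nat -> R) (V : nat -> int -> nat -> R) :=
  (forall l, (l <= k)%N -> V 0%N j0 l = U j0 l) /\
  (forall i l, (1 <= i < s)%N -> (l <= k)%N ->
    V i j0 l = rk_stage a b dt i (fun nu => V nu j0 l)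
      (fun nu => let c := V nu j0 in L j0 l (tl c) (tl c) c (tr c) (tr c))).

Definition prediction (V : nat -> int -> nat -> R)
    (P : nat -> nat -> nat -> R) :=
  forall l, (l <= k)%N ->
    predict a b M k (fun i => V i j0 l) (fun p i => P p i l).

(* The predicted values at (p, s) are those at (p + 1, 0). *)
Definition predicted (P : nat -> nat -> nat -> R) (p i : nat) : nat -> R :=
  if i == s then P p.+1 0%N else P p i.

Definition coarse_stages (U : int -> nat -> R) (V : nat -> int -> nat -> R) :=
  (forall (j : int) l, j < j0 -> (l <= k)%N -> V 0%N j l = U j l) /\
  (forall i (j : int) l, (1 <= i <= s)%N -> j < j0 -> (l <= k)%N ->
    V i j l = rk_stage a b dt i (fun nu => V nu j l)
      (fun nu => L j l (tr (V nu (j - 1))) (tl (V nu j)) (V nu j)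
                       (tr (V nu j)) (tl (V nu (j + 1))))).

Definition interface_traces (V : nat -> int -> nat -> R)
    (P : nat -> nat -> nat -> R) (W : nat -> nat -> int -> nat -> R)
    (t : nat -> nat -> R) :=
  let limited p i :=
    let c := predicted P p i in
    c 0%N + minmodTVB x CM (tr c - c 0%N)
      [:: W p i (j0 + 1) 0%N - c 0%N; c 0%N - V i (j0 - 1) 0%N] in
  [/\ t 0%N 0%N = tr (P 0%N 0%N),
      forall p i, (p.+1 < M)%N -> (1 <= i < s)%N -> t p i = limited p i,
      forall p, (p.+1 < M)%N -> t p.+1 0%N = limited p s &
      forall i, (1 <= i < s)%N -> t M.-1 i = tr (P M.-1 i)].

Definition fine_stages (U : int -> nat -> R) (P : nat -> nat -> nat -> R)
    (t : nat -> nat -> R) (Z W : nat -> nat -> int -> nat -> R) :=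
  [/\ forall (j : int) l, j0 < j -> (l <= k)%N -> W 0%N 0%N j l = U j l,
      forall p (j : int) l, (p.+1 < M)%N -> j0 < j -> (l <= k)%N ->
        W p.+1 0%N j l = W p s j l,
      forall p i (j : int) l, (p < M)%N -> (1 <= i <= s)%N -> j0 < j -> (l <= k)%N ->
        Z p i j l = rk_stage a b tau i (fun nu => W p nu j l)
          (fun nu => L j l
             (if j == j0 + 1 then t p nu else tr (W p nu (j - 1)))
             (tl (W p nu j)) (W p nu j)
             (tr (W p nu j)) (tl (W p nu (j + 1)))) &
      forall p i (j : int) l, (p < M)%N -> (1 <= i <= s)%N -> j0 < j -> (l <= k)%N ->
        W p i j l =
        if (p.+1 < M)%N
        then limit k x CM
               (fun j' => if j' <= j0 then predicted P p i else Z p i j') j l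
        else Z p i j l].

Definition correction (U : int -> nat -> R) (V : nat -> int -> nat -> R)
    (W : nat -> nat -> int -> nat -> R) (t : nat -> nat -> R)
    (C : nat -> nat -> R) :=
  (forall l, (l <= k)%N -> C 0%N l = U j0 l) /\
  (forall i l, (1 <= i <= s)%N -> (l <= k)%N ->
    C i l = rk_stage a b tau i (fun nu => C nu l)
      (fun nu => \sum_(p < M)
         L j0 l (tr (V nu (j0 - 1))) (tl (V nu j0)) (V nu j0)
                (t p nu) (tl (W p nu (j0 + 1))))).

Definition lts_step (U U' : int -> nat -> R) : Prop :=
  exists (V : nat -> int -> nat -> R) (P : nat -> nat -> nat -> R)
         (t : nat -> nat -> R) (Z W : nat -> nat -> int -> nat -> R)
         (C : nat -> nat -> R),
    [/\ local_stages U V /\ prediction V P,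
        coarse_stages U V,
        interface_traces V P W t /\ fine_stages U P t Z W,
        correction U V W t C &
        forall j l, (l <= k)%N ->
          U' j l = limit k x CM
            (fun j' => if j' < j0 then V s j'
                       else if j' == j0 then C s else W M.-1 s j') j l].

End LocalTimeStepping.

(* Main.v *)
Require Import Defs.
From HB Require Import structures.
From mathcomp Require Import all_boot all_order all_algebra.
From mathcomp Require Import all_classical all_reals all_analysis.
From mathcomp Require Import lra zify measurable_realfun.
Set Implicit Arguments.
Unset Strict Implicit.
Unset Printing Implicit Defensive.
Import Order.TTheory GRing.Theory Num.Theory.
Import numFieldNormedType.Exports.
Local Open Scope classical_set_scope.
Local Open Scope ring_scope.

(* In every cell the scheme changes the mass by the flux entering on the left
   minus the flux leaving on the right. Unrolling the Runge-Kutta recursion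
   turns the accumulated flux into a fixed linear combination of the stage
   fluxes, and the correction step uses on I_{j0} exactly the fluxes that the coarse
   neighbour (M times dt / M) and the fine neighbour (M substeps) have used; the
   limiters keep the cell averages. Hence the masses of [x_{-n}, x_n[ before and
   after a step differ by flux (-n) - flux n.

   An integrable piecewise polynomial on cells of width at least d has Legendre
   coefficients tending to 0 at both infinities. This passes to all stages:
   the quadrature is exact on phi', so that the operator L vanishes on the
   constant state 0, L is continuous there, and limiting never increases a
   coefficient. So both end fluxes converge to dt (sum_nu B_nu) f(0), and the
   difference tends to 0. *)

(** * Algebraic integration of polynomials over [-1, 1] *)

Section Antiderivative.
Variable R : realFieldType.
Implicit Types p q : {poly R}.

(* The coefficient of degree 0 is the junk value _ / 0 = 0. *)
Definition antideriv p : {poly R} := \poly_(i < (size p).+1) (p`_i.-1 / i%:R).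

Lemma coef_antideriv p i : (antideriv p)`_i = p`_i.-1 / i%:R.
Proof.
rewrite coef_poly; case: ltnP => // lti.
by rewrite nth_default ?mul0r //; case: i lti.
Qed.

Lemma deriv_antideriv p : (antideriv p)^`() = p.
Proof.
apply/polyP => i; rewrite coef_deriv coef_antideriv /=.
by rewrite -[RHS](divfK (_ : i.+1%:R != 0)) ?pnatr_eq0 // mulr_natr.
Qed.

(* The integral of p over [-1, 1], as an algebraic functional. *)
Definition span_int p : R := (antideriv p).[1] - (antideriv p).[-1].

Lemma span_intD p q : span_int (p + q) = span_int p + span_int q.
Proof.
rewrite /span_int.
have -> : antideriv (p + q) = antideriv p + antideriv q.
  by apply/polyP => i; rewrite coefD !coef_antideriv coefD mulrDl.
by rewrite !hornerD; lra.
Qed.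

Lemma span_intZ (c : R) p : span_int (c *: p) = c * span_int p.
Proof.
rewrite /span_int.
have -> : antideriv (c *: p) = c *: antideriv p.
  by apply/polyP => i; rewrite coefZ !coef_antideriv coefZ mulrA.
by rewrite !hornerZ mulrBr.
Qed.

Lemma span_int0 : span_int 0 = 0.
Proof. by rewrite -[X in span_int X](scale0r 0) span_intZ mul0r. Qed.

Lemma span_int_sum n (F : 'I_n -> {poly R}) :
  span_int (\sum_i F i) = \sum_i span_int (F i).
Proof.
apply: (big_morph span_int) => [p q|]; first exact: span_intD.
exact: span_int0.
Qed.

Lemma span_int_deriv p : span_int p^`() = p.[1] - p.[-1].
Proof.
(* The constant term lost by [antideriv] cancels between the two end points. *)
have -> : p = antideriv p^`() + (p`_0)%:P.
  apply/polyP => -[|i]; rewrite coefD coef_antideriv coefC /=.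
    by rewrite invr0 mulr0 add0r.
  by rewrite coef_deriv addr0 -[_ *+ i.+1]mulr_natr mulfK ?pnatr_eq0.
rewrite /span_int !hornerD !hornerC derivD derivC addr0 deriv_antideriv.
by rewrite opprD addrACA subrr addr0.
Qed.

End Antiderivative.

(** * Legendre polynomials: end point values, orthogonality, norm *)

Section Legendre.
Variable R : realType.
Implicit Types p q : {poly R}.

Let w : {poly R} := 'X ^+ 2 - 1.

Let horner_w e : e ^+ 2 = 1 -> w.[e] = 0.
Proof. by move=> e2; rewrite hornerD hornerN hornerXn hornerC e2 subrr. Qed.

(* The condition e ^+ 2 = 1 treats both end points of [-1, 1] at once. *)
Lemma derivn_pow_sqrX1 l i : (i <= l)%N -> exists2 q : {poly R},
  ((w ^+ l)^`(i) = w ^+ (l - i) * q) &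
  forall e, e ^+ 2 = 1 -> q.[e] = (l ^_ i)%:R * (2 * e) ^+ i.
Proof.
elim: i => [|i IH] lei.
  by exists 1; [rewrite subn0 mulr1 | move=> e _; rewrite hornerE mul1r].
have [q defq valq] := IH (ltnW lei).
(* Product rule on $w^{l-i}q$ with $w^{l-i-1}$ factored out. At the end points the second summand
   vanishes and $w'(e)=2e$. *)
exists ((l - i)%:R *: (w^`() * q) + w * q^`()).
  rewrite derivnS defq derivM deriv_exp -(subnSK lei) /= exprS mulrDr.
  congr (_ + _); last by rewrite mulrAC mulrC.
  rewrite scaler_nat mulrnAr mulrnAl; congr (_ *+ _).
  by rewrite mulrAC mulrC.
move=> e e2; rewrite ffactnSr natrM exprSr [w^`()]derivB derivXn derivC subr0.
rewrite /= hornerD !hornerM hornerZ hornerM horner_w // mul0r addr0 hornerMn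
  hornerX valq //.
by rewrite -[e *+ 2]mulr_natl; lra.
Qed.

(** For [i < l] a positive power of [w] survives, and [w] vanishes at both end points. This removes
    the boundary terms in the integrations by parts below. *)
Lemma derivn_pow_sqrX1_root l i e : (i < l)%N -> e ^+ 2 = 1 ->
  ((w ^+ l)^`(i)).[e] = 0.
Proof.
move=> lti e2; have [q -> _] := derivn_pow_sqrX1 (ltnW lti).
by rewrite hornerM horner_exp horner_w // expr0n subn_eq0 leqNgt lti mul0r.
Qed.

Lemma legendre_sqr1 l (e : R) : e ^+ 2 = 1 -> (legendre R l).[e] = e ^+ l.
Proof.
move=> e2; have [q defq valq] := derivn_pow_sqrX1 (leqnn l).
rewrite /legendre hornerZ defq subnn expr0 mul1r valq // ffactnn exprMn.
by rewrite (mulrA l`!%:R) (mulrC l`!%:R) mulrA mulVf ?mul1r // mulf_neq0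
  ?expf_neq0 ?pnatr_eq0 -?lt0n ?fact_gt0.
Qed.

Lemma span_int_by_parts p q : p.[1] * q.[1] = p.[-1] * q.[-1] ->
  span_int (p^`() * q) = - span_int (p * q^`()).
Proof.
move=> pq; apply/eqP; rewrite -subr_eq0 opprK -span_intD -derivM.
by rewrite span_int_deriv !hornerM pq subrr.
Qed.

(** Integration by parts [i] times: each step moves one derivative to [q], and the remaining order
    stays below [l], so no boundary term appears. *)
Lemma span_int_rodrigues l i q : (i <= l)%N ->
  span_int ((w ^+ l)^`(l) * q) =
  (-1) ^+ i * span_int ((w ^+ l)^`(l - i) * q^`(i)).
Proof.
elim: i => [|i IH] lei; first by rewrite subn0 mul1r.
rewrite IH ?(ltnW lei) // -subnSK // derivnS span_int_by_parts.
  by rewrite exprSr mulrN1 mulrN mulNr derivnS.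
by rewrite !derivn_pow_sqrX1_root ?mul0r ?sqrrN ?expr1n //; lia.
Qed.

Lemma span_int_legendreM l q :
  span_int (legendre R l * q) =
  (2 ^+ l * l`!%:R)^-1 * ((-1) ^+ l * span_int (w ^+ l * q^`(l))).
Proof. by rewrite -scalerAl span_intZ (span_int_rodrigues _ (leqnn l)) subnn.
  Qed.

Lemma size_pow_sqrX1 l : size (w ^+ l) = (2 * l).+1.
Proof.
have mw : w ^+ l \is monic by rewrite monic_exp // monic_Xn_sub_1.
by rewrite -[size _]prednK ?size_exp ?size_Xn_sub_1 // size_poly_gt0 monic_neq0.
Qed.

Lemma size_legendre l : (size (legendre R l) <= l.+1)%N.
Proof.
apply: leq_trans (size_scale_leq _ _) _; apply/leq_sizeP => j ltj.
by rewrite coef_derivn nth_default ?mul0rn // size_pow_sqrX1; lia.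
Qed.

(** In total $w^l$, monic of degree $2l$, is differentiated $2l$ times, which leaves $(2l)!$ up to
    the normalization. *)
Lemma derivn_legendre l : exists2 c : R, c != 0 & (legendre R l)^`(l) = c%:P.
Proof.
have mw : w ^+ l \is monic by rewrite monic_exp // monic_Xn_sub_1.
exists ((2 ^+ l * l`!%:R)^-1 * ((2 * l) ^_ (2 * l))%:R).
  rewrite ffactnn mulf_neq0 ?invr_eq0 ?mulf_neq0 ?expf_neq0 //;
  by rewrite pnatr_eq0 -?lt0n ?fact_gt0.
apply/polyP => i; rewrite /legendre derivnZ /derivn -iterD addnn -mul2n
  -/(derivn _ _) coefZ coef_derivn coefC.
case: i => [|i]; rewrite ?addn0 /=.
  have -> : (w ^+ l)`_(2 * l) = 1.
    by have /monicP := mw; rewrite lead_coefE size_pow_sqrX1.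
  by [].
by rewrite nth_default ?mul0rn ?mulr0 // size_pow_sqrX1; lia.
Qed.

(** Since $Xw^{l+1}$ vanishes at both end points, its derivative $(2l+3)w^{l+1}+(2l+2)w^l$ has
    integral zero. Hence consecutive integrals are nonzero multiples of each other. *)
Lemma span_int_pow_sqrX1_neq0 l : span_int (w ^+ l) != 0.
Proof.
elim: l => [|l IH].
  have -> : w ^+ 0 = ('X : {poly R})^`() by rewrite expr0 derivX.
  by rewrite span_int_deriv !hornerX opprK -(natrD _ 1 1) pnatr_eq0.
have: span_int ('X * w ^+ l.+1)^`() = 0.
  by rewrite span_int_deriv !hornerM !horner_exp !horner_w ?sqrrN ?expr1n //
    !expr0n !mulr0 subrr.
have -> : ('X * w ^+ l.+1)^`() =
    (2 * l.+1 + 1)%:R *: w ^+ l.+1 + (2 * l.+1)%:R *: w ^+ l.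
  have w' : w^`() = 'X *+ 2 by rewrite derivB derivXn derivC subr0.
  have X2 : 'X * 'X = w + 1 :> {poly R} by rewrite subrK expr2.
  rewrite derivM derivX mul1r deriv_exp /= w' mulrnAl -mulrnA mulrnAr mulrA X2.
  rewrite mulrDl mul1r -exprS mulrnDl !scaler_nat addn1.
  by rewrite [_ *+ (2 * _).+1]mulrS addrA.
rewrite span_intD !span_intZ => /eqP; rewrite addr_eq0 => /eqP eq0.
apply/negP => /eqP w0; move: eq0; rewrite w0 mulr0 => /esym/eqP.
by rewrite oppr_eq0 mulf_eq0 (negPf IH) orbF pnatr_eq0.
Qed.

(** Orthogonality: moving all [l] derivatives onto [q] annihilates it. *)
Lemma span_int_legendre_lt l q : (size q <= l)%N ->
  span_int (legendre R l * q) = 0.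
Proof.
by move=> leq; rewrite span_int_legendreM derivn_poly0 // mulr0 span_int0
  !mulr0.
Qed.

Lemma span_int_legendre_sqr l : span_int (legendre R l * legendre R l) != 0.
Proof.
have [c c0 defc] := derivn_legendre l.
rewrite span_int_legendreM defc [_ * c%:P]mulrC mul_polyC span_intZ.
by rewrite !mulf_neq0 ?span_int_pow_sqrX1_neq0 ?signr_eq0 // invr_eq0
  !mulf_neq0 ?expf_neq0 ?pnatr_eq0 -?lt0n ?fact_gt0.
Qed.

Lemma span_int_legendre_combination k (c : nat -> R) l : (l <= k)%N ->
  span_int ((\sum_(m < k.+1) c m *: legendre R m) * legendre R l) =
  c l * span_int (legendre R l * legendre R l).
Proof.
rewrite -ltnS => ltl; rewrite mulr_suml span_int_sum.
rewrite (bigD1 (Ordinal ltl)) //= big1 ?addr0 => [|m neqm].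
  by rewrite -scalerAl span_intZ.
rewrite -scalerAl span_intZ; have [ltml|ltlm|eqml] := ltngtP m l.
- by rewrite [legendre R m * _]mulrC span_int_legendre_lt ?mulr0 // (leq_trans
    (size_legendre m)).
- by rewrite span_int_legendre_lt ?mulr0 // (leq_trans (size_legendre l)).
- by case/eqP: neqm; apply: val_inj.
Qed.

Lemma legendre0 : legendre R 0 = 1.
Proof. by rewrite /legendre fact0 expr0 mulr1 invr1 scale1r. Qed.

End Legendre.

(** * Lebesgue integrals of polynomials and dominated convergence *)

Section Integrals.
Variable R : realType.
Local Notation mu := (@lebesgue_measure R).

Lemma integrable_poly (p : {poly R}) (c d : R) :
  mu.-integrable `[c, d] (EFin \o horner p).
Proof.
apply: continuous_compact_integrable; first exact: segment_compact.
by apply: continuous_subspaceT; exact: continuous_horner.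
Qed.

Lemma Rintegral_deriv_poly (P : {poly R}) (c d : R) : c < d ->
  \int[mu]_(y in `[c, d]) P^`().[y] = P.[d] - P.[c].
Proof.
move=> cd; rewrite /Rintegral (continuous_FTC2 (F := horner P)) //.
- by apply: continuous_subspaceT; exact: continuous_horner.
- split=> [y _||]; first exact: derivable_horner.
  + by apply: cvg_at_right_filter; exact: continuous_horner.
  + by apply: cvg_at_left_filter; exact: continuous_horner.
- by move=> y _; rewrite derivE.
Qed.

Lemma Rintegral_deriv_poly_oo (P : {poly R}) (c d : R) : c < d ->
  \int[mu]_(y in `]c, d[) P^`().[y] = P.[d] - P.[c].
Proof.
move=> cd; rewrite -(Rintegral_deriv_poly _ cd).
rewrite Rintegral_itv_bndo_bndc ?Rintegral_itv_obnd_cbnd //;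
  apply: integrableS (integrable_poly P^`() c d) => //;
  by apply: subset_itv; rewrite bnd_simp.
Qed.

(** Dominated convergence with majorant $B|v|$. It serves both for the decay of the coefficients and
    for the exhaustion of the line. *)
Lemma cvg_Rintegral_mul_bounded (v h : R -> R) (h_ : nat -> R -> R) (B : R) :
  mu.-integrable setT (EFin \o v) ->
  (forall n, measurable_fun setT (h_ n)) -> measurable_fun setT h ->
  (forall n y, `|h_ n y| <= B) -> (forall y, h_ n y @[n --> \oo] --> h y) ->
  \int[mu]_y (v y * h_ n y) @[n --> \oo] --> \int[mu]_y (v y * h y).
Proof.
move=> iv mh_ mh hB hcvg.
have mv : measurable_fun setT v.
  by apply/measurable_EFinP; exact: measurable_int iv.
have [] := @dominated_convergence _ _ R mu setT measurableT
    (fun n y => (v y * h_ n y)%:E) (fun y => (v y * h y)%:E)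
    (fun y => (B * `|v y|)%:E).
- move=> n; apply/measurable_EFinP; apply: measurable_funM=> //; exact: mh_.
- by apply/measurable_EFinP; exact: measurable_funM.
- apply/aeW => y _; apply: cvg_EFin; first exact: nearW.
  by apply: cvgMl_tmp; exact: hcvg.
- have := integrable_norm iv.
  by move=> /(integrableZl measurableT B); apply: eq_integrable.
- apply/aeW => y n _; rewrite lee_fin normrM mulrC.
  exact: ler_wpM2r.
move=> /integrable_fin_num fin _; rewrite -(fineK (fin measurableT)).
by move/fine_cvg.
Qed.

Lemma Rintegral_indic (D : set R) (v : R -> R) :
  \int[mu]_(y in D) v y = \int[mu]_y (v y * \1_D y).
Proof.
rewrite Rintegral_mkcond; apply: eq_Rintegral => y _.
by rewrite patchE indicE; case: ifP => _; rewrite ?mulr1 ?mulr0.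
Qed.

End Integrals.

(** * Cells, reference coordinates and Legendre moments *)

Section Cells.
Variables (R : realType) (x : int -> R).
Hypothesis hx : partitions_line x.
Local Notation mu := (@lebesgue_measure R).

Lemma mesh_le i j : i <= j -> x i <= x j.
Proof.
move=> ij; have -> : j = i + `|j - i|%N by lia.
elim: `|_|%N => [|n IH]; first by rewrite addr0.
rewrite intS addrCA addrA; apply: le_trans IH _.
by rewrite -[i + n in X in X <= _](addrK 1) [_ + 1]addrC addrA; exact/ltW/hx.1.
Qed.

Lemma width_gt0 j : 0 < width x j. Proof. by rewrite subr_gt0 hx.1. Qed.

Lemma cell_inj i j y : cell x i y -> cell x j y -> i = j.
Proof.
rewrite /cell /= !in_itv /= => /andP[yi iy] /andP[yj jy].
have [ij|ji|//] := ltgtP i j.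
- have /mesh_le : i <= j - 1 by lia.
  by rewrite leNgt (lt_trans yj iy).
- have /mesh_le : j <= i - 1 by lia.
  by rewrite leNgt (lt_trans yi jy).
Qed.

(** The affine map of the closed cell onto [-1, 1]; the basis functions are Legendre polynomials
    composed with it. *)
Definition cell_coord j : {poly R} :=
  (2 / width x j) *: ('X - (midpoint x j)%:P).

Lemma cell_coordE j y : (cell_coord j).[y] = 2 / width x j * (y - midpoint x j).
Proof. by rewrite hornerZ hornerXsubC. Qed.

Lemma deriv_cell_coord j : (cell_coord j)^`() = (2 / width x j)%:P.
Proof. by rewrite derivZ derivXsubC alg_polyC. Qed.

Lemma cell_coord_r j : (cell_coord j).[x j] = 1.
Proof.
have w0 := lt0r_neq0 (width_gt0 j); rewrite cell_coordE /midpoint.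
have -> : x j - (x (j - 1) + x j) / 2 = width x j / 2 by rewrite /width; lra.
by rewrite mulrA divfK // divff // pnatr_eq0.
Qed.

Lemma cell_coord_l j : (cell_coord j).[x (j - 1)] = -1.
Proof.
have w0 := lt0r_neq0 (width_gt0 j); rewrite cell_coordE /midpoint.
have -> : x (j - 1) - (x (j - 1) + x j) / 2 = - (width x j / 2) by rewrite
  /width; lra.
by rewrite mulrN mulrA divfK // divff // pnatr_eq0.
Qed.

Lemma cell_coord_le1 j y : cell x j y -> `|(cell_coord j).[y]| <= 1.
Proof.
rewrite /cell /= in_itv /= => /andP[ly yr].
rewrite ler_norml -[X in X <= _ <= _](cell_coord_l j) -[X in _ <= _ <=
  X](cell_coord_r j).
have w0 : 0 <= 2 / width x j by rewrite divr_ge0 ?ltW ?width_gt0.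
by rewrite !cell_coordE !ler_wpM2l // lerD2r ltW.
Qed.

Lemma phiE j l : phi x j l = legendre R l \Po cell_coord j. Proof. by []. Qed.

Lemma cell_polyE k j c :
  cell_poly x k j c = (\sum_(l < k.+1) c l *: legendre R l) \Po cell_coord j.
Proof.
by rewrite linear_sum; apply: eq_bigr => l _; rewrite linearZ.
Qed.

(** The change of variables is done on antiderivatives: composing with the affine coordinate costs
    the inverse slope [width x j / 2]. *)
Lemma Rintegral_cell_comp j (p : {poly R}) :
  \int[mu]_(y in cell x j) (p \Po cell_coord j).[y] =
  width x j / 2 * span_int p.
Proof.
have w0 := lt0r_neq0 (width_gt0 j).
set P := (width x j / 2) *: (antideriv p \Po cell_coord j).
have -> : p \Po cell_coord j = P^`().
  rewrite derivZ deriv_comp deriv_antideriv deriv_cell_coord [_ * _%:P]mulrC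
    mul_polyC.
  by rewrite scalerA mulrA divfK ?pnatr_eq0 // divff // scale1r.
rewrite Rintegral_deriv_poly_oo ?hx.1 // /P !hornerZ !horner_comp.
by rewrite cell_coord_r cell_coord_l -mulrBr.
Qed.

Section Coefficients.
Variables (k : nat) (v : R -> R) (U : int -> nat -> R).
Hypothesis vU : has_coefs x k v U.

(* span_int (legendre l ^ 2) stands for 2 / (2 l + 1); only its being nonzero
   matters. *)
Lemma Rintegral_cell_legendre j l : (l <= k)%N ->
  \int[mu]_(y in cell x j) (v y * (phi x j l).[y]) =
  width x j / 2 * (U j l * span_int (legendre R l * legendre R l)).
Proof.
move=> lk; rewrite -(span_int_legendre_combination _ lk) -Rintegral_cell_comp.
apply: eq_Rintegral => y /set_mem yj.
by rewrite (vU yj) cell_polyE phiE -hornerM rmorphM.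
Qed.

Lemma Rintegral_cell_mean j :
  \int[mu]_(y in cell x j) v y = width x j * U j 0%N.
Proof.
transitivity (\int[mu]_(y in cell x j) (v y * (phi x j 0).[y])).
  by apply: eq_Rintegral => y _; rewrite phiE legendre0 comp_polyC hornerC
    mulr1.
rewrite Rintegral_cell_legendre // legendre0 mulr1.
have -> : 1 = ('X : {poly R})^`() by rewrite derivX.
rewrite span_int_deriv !hornerX; lra.
Qed.

End Coefficients.

End Cells.

(** * Elementary bounds *)

Lemma cvg0_dominated (R : realType) (T : Type) (F : set_system T)
    {FF : Filter F} (u v : T -> R) (C : R) :
  (\forall i \near F, `|u i| <= C * `|v i|) -> v i @[i --> F] --> 0 ->
  u i @[i --> F] --> 0.
Proof.
move=> uv /cvg_norm; rewrite normr0 => v0; apply/norm_cvg0P.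
apply: (@squeeze_cvgr _ F _ _ (cst 0) (fun i => C * `|v i|)).
- by apply: filterS uv => i ->; rewrite normr_ge0.
- exact: cvg_cst.
- by rewrite -[X in _ --> X](mulr0 C); exact: cvgMl_tmp.
Qed.

(** The bound is uniform in [y], hence bounds a basis function on all cells at once. *)
Lemma horner_norm_le (R : realType) (p : {poly R}) (y : R) :
  `|y| <= 1 -> `|p.[y]| <= \sum_(i < size p) `|p`_i|.
Proof.
move=> y1; rewrite horner_coef (le_trans (ler_norm_sum _ _ _)) //.
apply: ler_sum => i _; rewrite normrM normrX ler_piMr //.
exact: exprn_ile1.
Qed.

(** * Decay of coefficients and total mass as a limit *)

Section Masses.
Variables (R : realType) (x : int -> R).
Hypothesis hx : partitions_line x.
Local Notation mu := (@lebesgue_measure R).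

Section OneFunction.
Variables (k : nat) (v : R -> R) (U : int -> nat -> R).
Hypotheses (iv : mu.-integrable setT (EFin \o v)) (vU : has_coefs x k v U).

(** The cells [J n] leave every fixed cell, so the moments of [v] against their basis functions tend
    to 0 by dominated convergence. Widths bounded below carry this over to the coefficients. *)
Lemma coefs_vanish (d : R) (J : nat -> int) l : 0 < d ->
  (forall j, d <= width x j) -> (forall i, \forall n \near \oo, J n != i) ->
  (l <= k)%N -> U (J n) l @[n --> \oo] --> 0.
Proof.
move=> d0 hd hJ lk.
set B := \sum_(i < size (legendre R l)) `|(legendre R l)`_i|.
pose h n (y : R) := (phi x (J n) l).[y] * \1_(cell x (J n)) y : R.
have B0 : 0 <= B by apply: sumr_ge0.
have mcell j : measurable (cell x j) by exact: measurable_itv.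
have : \int[mu]_y (v y * h n y) @[n --> \oo] --> \int[mu]_y (v y * cst 0 y).
  apply: (cvg_Rintegral_mul_bounded iv (B := B)) => //.
  - move=> n; apply: measurable_funM; first exact: measurable_poly.
    by apply: measurable_indic.
  - move=> n y; rewrite /h indicE; case: (boolP (y \in _)) => /=; rewrite
      ?mulr0 ?normr0 //.
    move=> /set_mem yc; rewrite mulr1 phiE horner_comp.
    by apply: horner_norm_le; exact: cell_coord_le1.
  (* A point lies in at most one cell, which [J n] eventually avoids; mesh points lie in none. *)
  - move=> y; have [[j yj]|noj] := pselect (exists j, cell x j y).
      apply: cvg_near_cst; apply: filterS (hJ j) => n neqj.
      rewrite /h indicE memNset ?mulr0 // => yn.
      by rewrite (cell_inj hx yn yj) eqxx in neqj.
    apply: cvg_near_cst; apply: nearW => n.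
    by rewrite /h indicE memNset ?mulr0 // => yn; apply: noj; exists (J n).
have -> : \int[mu]_y (v y * cst 0 y) = 0.
  transitivity (\int[mu]_y (0 * v y)).
    by apply: eq_Rintegral => y _; rewrite mulr0 mul0r.
  by rewrite RintegralZl ?mul0r.
have nrm0 := span_int_legendre_sqr R l; set nrm := span_int _ in nrm0.
(* The moment equals [width / 2 * U * nrm], and the width is at least [d]. *)
apply: (cvg0_dominated (C := 2 / (d * `|nrm|))); apply: nearW => n.
rewrite [X in _ <= _ * `|X|](_ : _ =
    \int[mu]_(y in cell x (J n)) (v y * (phi x (J n) l).[y])); last first.
  rewrite [RHS]Rintegral_indic; apply: eq_Rintegral => y _.
  by rewrite /h mulrA.
rewrite (Rintegral_cell_legendre hx vU) // -/nrm !normrM.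
have w0 := width_gt0 hx (J n); have n0 : 0 < `|nrm| by rewrite normr_gt0.
rewrite (gtr0_norm w0) (gtr0_norm (_ : 0 < 2^-1)) ?invr_gt0 //.
rewrite [X in _ <= X](_ : _ = width x (J n) / d * `|U (J n) l|); last first.
  have e : `|nrm| * `|nrm|^-1 = 1 by rewrite mulfV ?gt_eqF.
  rewrite -[RHS]mulr1 -[X in _ = _ * X]e invfM.
  move: (`|nrm|) (`|nrm|^-1) (d^-1) (width _ _) (`|U _ _|) => m m' d' w u; lra.
by rewrite ler_peMl // ler_pdivlMr // mul1r.
Qed.

Lemma mass_exhaustion :
  \int[mu]_(y in `[x (- n%:Z), x n%:Z[) v y @[n --> \oo] --> \int[mu]_y v y.
Proof.
pose h (n : nat) (y : R) := \1_(`[x (- n%:Z), x n%:Z[) y : R.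
rewrite (_ : (fun n : nat => _) = (fun n => \int[mu]_y (v y * h n y)));
  last by apply/funext => n; rewrite Rintegral_indic.
have -> : \int[mu]_y v y = \int[mu]_y (v y * cst 1 y).
  by apply: eq_Rintegral => y _; rewrite mulr1.
apply: (cvg_Rintegral_mul_bounded iv (B := 1)) => //.
- by move=> n; apply: measurable_indic; exact: measurable_itv.
- by move=> n y; rewrite /h indicE; case: (y \in _); rewrite ?normr1 ?normr0.
- move=> y; apply: cvg_near_cst; have [j /andP[jy yj]] := hx.2 y.
  near=> n; have jn : (`|j| < n)%N by near: n; exact: nbhs_infty_gt.
  rewrite /h indicE mem_set //= in_itv /=; apply/andP; split.
    by apply: le_trans jy; apply: mesh_le => //; lia.
  by apply: lt_le_trans yj _; apply: mesh_le => //; lia.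
Unshelve. all: by end_near. Qed.

Lemma mass_cell_closed j :
  \int[mu]_(y in `[x (j - 1), x j[) v y = width x j * U j 0%N.
Proof.
rewrite -(Rintegral_cell_mean hx vU) /cell Rintegral_itv_obnd_cbnd //.
by apply: integrableS iv.
Qed.

Lemma mass_split (i j l : int) : i <= j -> j <= l ->
  \int[mu]_(y in `[x i, x l[) v y =
  \int[mu]_(y in `[x i, x j[) v y + \int[mu]_(y in `[x j, x l[) v y.
Proof.
move=> ij jl; rewrite -Rintegral_setU //; last 2 first.
- by apply: integrableS iv => //; exact: measurableU.
- apply/disj_setPS => y /= []; rewrite !in_itv /= => /andP[_ yj] /andP[jy _].
  by move: yj; rewrite ltNge jy.
- by rewrite -itv_bndbnd_setU // bnd_simp; exact: mesh_le.
Qed.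

(** As [x j] is the right end point of cell [j], the cells added are $-n$ on the left and $n+1$ on
    the right. *)
Lemma mass_increment (n : nat) :
  \int[mu]_(y in `[x (- n.+1%:Z), x n.+1%:Z[) v y =
  \int[mu]_(y in `[x (- n%:Z), x n%:Z[) v y +
  (width x (- n%:Z) * U (- n%:Z) 0%N + width x n.+1%:Z * U n.+1%:Z 0%N).
Proof.
have cellN := mass_cell_closed (- n%:Z); have cellP := mass_cell_closed n.+1%:Z.
have eN : - n%:Z - 1 = - n.+1%:Z by lia.
have eP : n.+1%:Z - 1 = n%:Z by lia.
rewrite eN in cellN; rewrite eP in cellP; rewrite -cellN -cellP.
have split1 : \int[mu]_(y in `[x (- n.+1%:Z), x n.+1%:Z[) v y =
    \int[mu]_(y in `[x (- n.+1%:Z), x (- n%:Z)[) v y +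
    \int[mu]_(y in `[x (- n%:Z), x n.+1%:Z[) v y by apply: mass_split; lia.
have split2 : \int[mu]_(y in `[x (- n%:Z), x n.+1%:Z[) v y =
    \int[mu]_(y in `[x (- n%:Z), x n%:Z[) v y +
    \int[mu]_(y in `[x n%:Z, x n.+1%:Z[) v y by apply: mass_split; lia.
by rewrite split1 split2 addrCA.
Qed.

End OneFunction.

(** Interior fluxes cancel in pairs. The two end fluxes may have a nonzero limit, but it is the same
    one, so their difference disappears. *)
Lemma mass_telescope k (v v' : R -> R) (U U' : int -> nat -> R)
    (flux : int -> R) (c : R) :
  mu.-integrable setT (EFin \o v) -> has_coefs x k v U ->
  mu.-integrable setT (EFin \o v') -> has_coefs x k v' U' ->
  (forall j, width x j * U' j 0%N =
             width x j * U j 0%N + (flux (j - 1) - flux j)) ->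
  flux (- n%:Z) @[n --> \oo] --> c -> flux n%:Z @[n --> \oo] --> c ->
  \int[mu]_y v' y = \int[mu]_y v y.
Proof.
move=> iv vU iv' vU' step fluxN fluxP.
have defm n : \int[mu]_(y in `[x (- n%:Z), x n%:Z[) v' y =
    \int[mu]_(y in `[x (- n%:Z), x n%:Z[) v y + (flux (- n%:Z) - flux n%:Z).
  elim: n => [|n IH].
    by rewrite oppr0 subrr addr0 set_itvco0 !Rintegral_set0.
  rewrite (mass_increment iv vU) (mass_increment iv' vU') IH !step.
  have -> : - n%:Z - 1 = - n.+1%:Z by lia.
  have -> : n.+1%:Z - 1 = n%:Z by lia.
  lra.
have lim' := mass_exhaustion iv'.
rewrite (funext defm : (fun n : nat => _) = _) in lim'.
have lim : \int[mu]_(y in `[x (- n%:Z), x n%:Z[) v y + (flux (- n%:Z) - flux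
  n%:Z)
    @[n --> \oo] --> \int[mu]_y v y.
  rewrite -[X in _ --> X]addr0 -(subrr c).
  by apply: cvgD; [exact: mass_exhaustion | exact: cvgB].
exact: (cvg_unique (@norm_hausdorff _ _) lim' lim).
Qed.

End Masses.

(** * Limits of finite sums and continuity of the flux *)

Section Decay.
Variable R : realType.

Lemma cvg_sum_ord (T : Type) (F : set_system T) {FF : Filter F} (n : nat)
    (u : 'I_n -> T -> R) (l : 'I_n -> R) :
  (forall i, u i j @[j --> F] --> l i) ->
  \sum_i u i j @[j --> F] --> \sum_i l i.
Proof. by move=> ul; apply: cvg_big => //; exact: add_continuous. Qed.

Lemma cvg_sum_ord0 (T : Type) (F : set_system T) {FF : Filter F} (n : nat)
    (u : 'I_n -> T -> R) :
  (forall i, u i j @[j --> F] --> 0) -> \sum_i u i j @[j --> F] --> 0.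
Proof.
move=> u0; have H : \sum_i u i j @[j --> F] --> \sum_(i < n) (0 : R).
  exact: cvg_sum_ord.
by rewrite [X in _ --> X]big1 in H.
Qed.

Lemma locally_lipschitz2_continuous (g : R -> R -> R) (z : R * R) :
  locally_lipschitz2 g -> g y.1 y.2 @[y --> z] --> g z.1 z.2.
Proof.
move=> /(_ z) [V Vz /pinfty_ex_gt0 [M M0 lipM]].
apply/cvgrPdist_lt => e e0.
have nz : \forall y \near z, `|z - y| < e / M.
  have /cvgrPdist_lt : id y @[y --> z] --> z by exact: cvg_id.
  by apply; exact: divr_gt0.
have Vz0 := nbhs_singleton Vz; apply: filterS2 Vz nz => y Vy zy.
have /= lipzy := lipM (z, y) (conj Vz0 Vy).
by rewrite (le_lt_trans lipzy) // mulrC -ltr_pdivlMr.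
Qed.

End Decay.

(** * The spatial operator: local conservation and behaviour near the zero state *)

Section Operator.
Variables (R : realType) (k : nat) (x : int -> R).
Hypothesis hx : partitions_line x.
Variables (f : R -> R) (g : R -> R -> R) (q : nat) (xi om : 'I_q.+2 -> R).

Lemma cell_coord_node j i : (cell_coord x j).[node x xi j i] = xi i.
Proof.
have w0 := lt0r_neq0 (width_gt0 hx j).
rewrite cell_coordE /node addrAC subrr add0r mulrA.
by rewrite -[_ / _ * _]mulrA [_ * (_ / 2)]mulrA mulVf // mul1r divff ?mul1r
  ?pnatr_eq0.
Qed.

Definition ref_node_value (up : R) (c : nat -> R) (um : R) (i : 'I_q.+2) : R :=
  if i == ord0 then up
  else if i == ord_max then um
  else \sum_(m < k.+1) c m * (legendre R m).[xi i].

Lemma node_valueE j up c um i :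
  node_value k x xi j up c um i = ref_node_value up c um i.
Proof.
rewrite /node_value /ref_node_value; do 2!case: eqP => // _.
rewrite cell_polyE horner_comp cell_coord_node horner_sum.
by apply: eq_bigr => m _; rewrite hornerZ.
Qed.

(* The bracket of Lh pulled back to [-1, 1]: the cell enters only through the
   coefficients, so its limit along a sequence of cells can be taken. *)
Definition ref_residual l (lm lp : R) (c : nat -> R) (rm rp : R) : R :=
  \sum_i om i * (f (ref_node_value lp c rm i) * ((legendre R l)^`()).[xi i])
  - (g rm rp - (-1) ^+ l * g lm lp).

(** The factor [width / 2] of the quadrature cancels the slope [2 / width] from the chain rule. *)
Lemma LhE j l lm lp c rm rp :
  Lh k x f g xi om j l lm lp c rm rp =
  (2 * l + 1)%:R / width x j * ref_residual l lm lp c rm rp.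
Proof.
have w0 := lt0r_neq0 (width_gt0 hx j).
rewrite /Lh /ref_residual; congr (_ * (_ - _)); rewrite mulr_sumr.
apply: eq_bigr => i _; rewrite node_valueE phiE deriv_comp hornerM horner_comp.
rewrite cell_coord_node deriv_cell_coord hornerC.
have e : width x j * (width x j)^-1 = 1 by rewrite divff.
rewrite -[RHS]mulr1 -[X in _ = _ * X]e.
move: (f _) (horner _ _) (width _ _) (width _ _)^-1 => u v w w'; lra.
Qed.

(** The basis function of degree 0 is constant, so the quadrature term drops out and only the flux
    difference remains. *)
Lemma Lh0 j lm lp c rm rp :
  width x j * Lh k x f g xi om j 0 lm lp c rm rp = g lm lp - g rm rp.
Proof.
have w0 := lt0r_neq0 (width_gt0 hx j).
rewrite LhE mul1r mulrA divff // mul1r /ref_residual big1 => [|i _].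
  by rewrite expr0 mul1r sub0r opprB.
by rewrite legendre0 derivC hornerC !mulr0.
Qed.

Hypothesis hg : numerical_flux f g.
Hypothesis hq : gauss_lobatto xi om.
Hypothesis hqk : (k <= (2 * q).+2)%N.

(** The integrand has size at most [l], within the exactness range, so the rule returns
    $P_l(1)-P_l(-1)$. This is what balances the fluxes of a constant state. *)
Lemma quadrature_deriv_legendre l : (l <= k)%N ->
  \sum_i om i * ((legendre R l)^`()).[xi i] = 1 - (-1) ^+ l.
Proof.
move=> lk; have [_ _ _ exactness] := hq; rewrite exactness.
  rewrite Rintegral_deriv_poly; last by lra.
  by rewrite !legendre_sqr1 ?sqrrN ?expr1n.
have size_p : (size (legendre R l)^`() <= l)%N.
  apply/leq_sizeP => i li.
  by rewrite coef_deriv nth_default ?mul0rn // (leq_trans (size_legendre _ l)).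
exact: leq_trans size_p (leq_trans lk hqk).
Qed.

Section Filter.
Variables (F : set_system int) (FF : Filter F).

(** The filter is abstract so that one argument covers both ends of the line. *)
Definition vanishing (c : int -> nat -> R) :=
  forall l, (l <= k)%N -> c j l @[j --> F] --> 0.

Lemma trace_r_vanishing c : vanishing c -> trace_r k (c j) @[j --> F] --> 0.
Proof.
by move=> c0; apply: cvg_sum_ord0 => l; apply: c0; rewrite -ltnS.
Qed.

Lemma trace_l_vanishing c : vanishing c -> trace_l k (c j) @[j --> F] --> 0.
Proof.
move=> c0; apply: cvg_sum_ord0 => l; rewrite -[X in _ --> X](mulr0 ((-1) ^+ l)).
by apply: cvgMl_tmp; apply: c0; rewrite -ltnS.
Qed.

Lemma flux_vanishing (lm lp : int -> R) :
  lm j @[j --> F] --> 0 -> lp j @[j --> F] --> 0 ->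
  g (lm j) (lp j) @[j --> F] --> f 0.
Proof.
move=> lm0 lp0; have [lipg gf _ _] := hg; rewrite -gf.
apply: continuous2_cvg lm0 lp0.
exact: (@locally_lipschitz2_continuous _ g (0, 0)).
Qed.

Lemma Lh_vanishing (d : R) l (lm lp rm rp : int -> R) (c : int -> nat -> R) :
  0 < d -> (forall j, d <= width x j) -> (l <= k)%N -> vanishing c ->
  lm j @[j --> F] --> 0 -> lp j @[j --> F] --> 0 ->
  rm j @[j --> F] --> 0 -> rp j @[j --> F] --> 0 ->
  Lh k x f g xi om j l (lm j) (lp j) (c j) (rm j) (rp j) @[j --> F] --> 0.
Proof.
move=> d0 hd lk c0 lm0 lp0 rm0 rp0.
apply: (@cvg0_dominated _ _ _ _ _ (fun j =>
    ref_residual l (lm j) (lp j) (c j) (rm j) (rp j)) ((2 * l + 1)%:R / d)).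
  apply: nearW => j; rewrite LhE normrM ler_wpM2r // normrM normfV normr_nat.
  by rewrite ler_wpM2l // gtr0_norm ?width_gt0 // lef_pV2 ?posrE ?width_gt0.
have [_ gf _ _] := hg.
(* The limit 0 is written as the residual of the zero state, so that limits can be taken term by
   term. *)
have -> : 0 = \sum_i om i * (f 0 * ((legendre R l)^`()).[xi i])
              - (f 0 - (-1) ^+ l * f 0).
  have -> : \sum_i om i * (f 0 * ((legendre R l)^`()).[xi i]) =
      f 0 * (1 - (-1) ^+ l).
    by rewrite -quadrature_deriv_legendre // mulr_sumr; apply: eq_bigr => i _;
      rewrite mulrCA.
  by rewrite mulrBr mulr1 [f 0 * _]mulrC subrr.
apply: cvgB; last first.
  apply: cvgB; first exact: flux_vanishing.
  by apply: cvgMl_tmp; exact: flux_vanishing.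
apply: cvg_sum_ord => i; apply: cvgMl_tmp; apply: cvgMr_tmp.
have node0 : ref_node_value (lp j) (c j) (rm j) i @[j --> F] --> 0.
  rewrite /ref_node_value; case: eqP => // _; case: eqP => // _.
  apply: cvg_sum_ord0 => m; rewrite -[X in _ --> X](mul0r (legendre R m).[xi
    i]).
  by apply: cvgMr_tmp; apply: c0; rewrite -ltnS.
(* By consistency, continuity of [f] at 0 is that of [g] on the diagonal. *)
have := flux_vanishing node0 node0.
by under eq_fun do rewrite gf.
Qed.

Lemma rk_stage_vanishing (a b : nat -> nat -> R) (tau : R) i
    (y dy : int -> nat -> R) :
  (forall nu, (nu < i)%N -> y j nu @[j --> F] --> 0) ->
  (forall nu, (nu < i)%N -> dy j nu @[j --> F] --> 0) ->
  rk_stage a b tau i (y j) (dy j) @[j --> F] --> 0.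
Proof.
move=> y0 dy0; apply: cvg_sum_ord0 => nu; rewrite -[X in _ --> X]addr0;
  apply: cvgD.
  by rewrite -[X in _ --> X](mulr0 (a i nu)); apply: cvgMl_tmp; exact: y0.
by rewrite -[X in _ --> X](mulr0 (b i nu * tau)); apply: cvgMl_tmp; exact: dy0.
Qed.

End Filter.

End Operator.

(** * Limiter: preserved means and coefficient bounds *)

Section Limiter.
Variables (R : realType) (k : nat) (x : int -> R) (CM : R).

Lemma minmod_norm_le (a : R) s : `|minmod a s| <= `|a|.
Proof.
rewrite /minmod; case: ifP => _; last by rewrite normr0.
have /andP[m0 ma] : 0 <= \big[Num.min/`|a|]_(c <- s) `|c| <= `|a|.
  elim/big_rec: _ => [|c m _ /andP[m0 ma]]; first by rewrite normr_ge0 lexx.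
  by rewrite le_min normr_ge0 m0 ge_min ma orbT.
rewrite normrM (ger0_norm m0) -[X in _ <= X]mul1r ler_pM //.
by rewrite normr_sg lern1 leq_b1.
Qed.

Lemma minmodTVB_norm_le (a : R) s : `|minmodTVB x CM a s| <= `|a|.
Proof. by rewrite /minmodTVB; case: ifP => // _; exact: minmod_norm_le. Qed.

Lemma limit_mean U j : limit k x CM U j 0%N = U j 0%N.
Proof. by rewrite /limit; case: ifP. Qed.

(** The bound involves cell [j] alone although the limiter reads its neighbours, so decay passes
    through limiting cell by cell. *)
Lemma limit_norm_le U j l : `|limit k x CM U j l| <= `|U j l|.
Proof.
rewrite /limit; case: ifP => // _; case: l => [|[|l]] //=.
  exact: minmodTVB_norm_le.
by rewrite normr0.
Qed.

End Limiter.

(** * Runge-Kutta schemes in Butcher form *)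

Section Weights.
Variable R : realType.

(* B holds the weights of the same scheme written in Butcher form: consistency
   of the rows of a carries y 0 through unchanged. *)
Lemma rk_weights (a b : nat -> nat -> R) (s : nat) :
  (forall i, (1 <= i <= s)%N -> \sum_(nu < i) a i nu = 1) ->
  exists B : nat -> R, forall (tau : R) (y dy : nat -> R),
    (forall i, (1 <= i <= s)%N -> y i = rk_stage a b tau i y dy) ->
    y s = y 0%N + tau * \sum_(mu < s) B mu * dy mu.
Proof.
move=> a1.
(* The weights are chosen before [tau], [y] and [dy]: the same ones must serve coarse cells, fine
   cells and the correction. *)
suff H n : (n <= s)%N -> exists B : nat -> nat -> R,
    forall (tau : R) (y dy : nat -> R),
      (forall i, (1 <= i <= s)%N -> y i = rk_stage a b tau i y dy) ->
      forall i, (i <= n)%N -> y i = y 0%N + tau * \sum_(mu < s) B i mu * dy mu.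
  by have [B HB] := H s (leqnn s); exists (B s) => tau y dy /HB ->.
elim: n => [_|n IH lens].
  exists (fun _ _ => 0) => tau y dy _ i; rewrite leqn0 => /eqP ->.
  by rewrite big1 ?mulr0 ?addr0 // => mu _; rewrite mul0r.
have [B HB] := IH (ltnW lens).
(* New row: the [a]-combination of the earlier rows plus the direct contribution of [b], placed at
   its index by a Kronecker delta. *)
exists (fun i mu => if i == n.+1 then
    \sum_(nu < n.+1) (a n.+1 nu * B nu mu + b n.+1 nu * (nu == mu :> nat)%:R)
  else B i mu) => tau y dy ydef i.
move=> lei; have [->|nei] /= := eqVneq i n.+1; last first.
  by apply: HB => //; lia.
rewrite ydef // /rk_stage.
under [LHS]eq_bigr => nu _ do rewrite (HB tau y dy ydef nu (ltn_ord nu)) mulrDr.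
rewrite !big_split /= -mulr_suml a1 // mul1r -addrA; congr (_ + _).
under [in RHS]eq_bigr => mu _ do rewrite mulr_suml.
rewrite exchange_big mulr_sumr -big_split /=; apply: eq_bigr => nu _.
under [in RHS]eq_bigr => mu _ do rewrite mulrDl.
rewrite big_split /= mulrDr; congr (_ + _).
  rewrite mulrCA; congr (_ * _); rewrite mulr_sumr; apply: eq_bigr => mu _.
  by rewrite mulrA.
have nus : (nu < s)%N by exact: leq_trans lens.
rewrite (bigD1 (Ordinal nus)) //= eqxx big1 => [|mu neq].
  by rewrite mulr1 addr0 mulrA [tau * _]mulrC.
have -> : (nu == mu :> nat) = false.
  by apply: contraNF neq => /eqP e; apply/eqP/val_inj.
by rewrite mulr0 mul0r.
Qed.

Lemma ssp_rk_consistent k (a b : nat -> nat -> R) : ssp_rk k a b ->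
  forall i, (1 <= i <= stages k)%N -> \sum_(nu < i) a i nu = 1.
Proof.
case: k => [|[|[|[|]]]] //=.
- case=> -> _ [|[|[|]]] // _.
  + by rewrite big_ord1.
  + rewrite !big_ord_recl big_ord0 /rk22_alpha /tab /=; lra.
- case=> -> _ [|[|[|[|]]]] // _.
  + by rewrite big_ord1.
  + rewrite !big_ord_recl big_ord0 /rk33_alpha /tab /=; lra.
  + rewrite !big_ord_recl big_ord0 /rk33_alpha /tab /=; lra.
- by case.
Qed.

End Weights.

(** * One local time step: decay of the stages and flux balance *)

Section Step.
Variables (R : realType) (k : nat) (x : int -> R).
Hypothesis hx : partitions_line x.
Variable d : R.
Hypotheses (d0 : 0 < d) (hd : forall j, d <= width x j).
Variables (f : R -> R) (g : R -> R -> R) (q : nat) (xi om : 'I_q.+2 -> R).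
Hypotheses (hg : numerical_flux f g) (hq : gauss_lobatto xi om).
Hypothesis hqk : (k <= (2 * q).+2)%N.
Variables (a b : nat -> nat -> R) (CM dt : R) (M : nat) (j0 : int).
Hypothesis M0 : (0 < M)%N.
Hypothesis a1 : forall i, (1 <= i <= stages k)%N -> \sum_(nu < i) a i nu = 1.
Variable U : int -> nat -> R.

Section Decay.
Variables (F : set_system int) (FF : Filter F).
Hypotheses (Fsucc : (fun j => j + 1) @ F `=>` F)
           (Fpred : (fun j => j - 1) @ F `=>` F).
Hypothesis U0 : vanishing k F U.

(** Fluxes of cell [j] read cells [j - 1] and [j + 1]; a shift-invariant filter transports decay to
    them. *)
Lemma vanishing_shift (h : int -> int) (c : int -> nat -> R) :
  h @ F `=>` F -> vanishing k F c -> vanishing k F (fun j => c (h j)).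
Proof. by move=> hF c0 l lk; apply: cvg_comp hF (c0 l lk). Qed.

Lemma coarse_vanishing V : (\forall j \near F, j < j0) ->
  coarse_stages k x f g xi om a b dt j0 U V ->
  forall i, (i <= stages k)%N -> vanishing k F (V i).
Proof.
move=> Fj [V0 VS]; elim/ltn_ind => -[_ _|i IH lei] l lk.
  apply: (@cvg0_dominated _ _ F _ _ (U^~ l) 1); last exact: U0.
  by apply: filterS Fj => j jj; rewrite V0 // mul1r.
pose L nu j := Lh k x f g xi om j l (trace_r k (V nu (j - 1)))
  (trace_l k (V nu j)) (V nu j) (trace_r k (V nu j))
  (trace_l k (V nu (j + 1))).
apply: (@cvg0_dominated _ _ F _ _
  (fun j => rk_stage a b dt i.+1 (fun nu => V nu j l) (fun nu => L nu j)) 1).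
  by apply: filterS Fj => j jj; rewrite VS // mul1r.
have VF nu : (nu < i.+1)%N -> vanishing k F (V nu).
  by move=> lti; apply: IH => //; exact: ltnW (leq_trans lti lei).
apply: rk_stage_vanishing => nu lti; first exact: VF.
apply: (Lh_vanishing hx hg hq hqk FF d0 hd lk (VF _ lti)).
- exact: trace_r_vanishing (vanishing_shift Fpred (VF _ lti)).
- exact: trace_l_vanishing (VF _ lti).
- exact: trace_r_vanishing (VF _ lti).
- exact: trace_l_vanishing (vanishing_shift Fsucc (VF _ lti)).
Qed.

(** Induction on substeps, and on stages within each. The margin [j0 + 1 < j] excludes the cell that
    reads the predicted trace. *)
Lemma fine_vanishing P t Z W : (\forall j \near F, j0 + 1 < j) ->
  fine_stages k x f g xi om a b CM dt M j0 U P t Z W ->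
  forall p i, (p < M)%N -> (i <= stages k)%N -> vanishing k F (W p i).
Proof.
move=> Fj [W00 WS0 Zdef Wdef].
suff stepW p : (p < M)%N -> vanishing k F (W p 0%N) ->
    forall i, (i <= stages k)%N -> vanishing k F (W p i).
  elim=> [|p IH] i ltp lei; apply: stepW => // l lk.
    apply: (@cvg0_dominated _ _ F _ _ (U^~ l) 1); last exact: U0.
    by apply: filterS Fj => j jj; rewrite W00 ?mul1r //; lia.
  apply: (@cvg0_dominated _ _ F _ _ ((W p (stages k))^~ l) 1); last first.
    exact: IH (ltnW ltp) (leqnn _) _ lk.
  by apply: filterS Fj => j jj; rewrite WS0 ?mul1r //; lia.
move=> ltp Wp0; elim/ltn_ind => -[//|i IH lei] l lk.
pose L nu j := Lh k x f g xi om j l (trace_r k (W p nu (j - 1)))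
  (trace_l k (W p nu j)) (W p nu j) (trace_r k (W p nu j))
  (trace_l k (W p nu (j + 1))).
apply: (@cvg0_dominated _ _ F _ _ (fun j =>
  rk_stage a b (dt / M%:R) i.+1 (fun nu => W p nu j l) (fun nu => L nu j)) 1).
  apply: filterS Fj => j jj; have lj : j0 < j by lia.
  have Zj : Z p i.+1 j l = rk_stage a b (dt / M%:R) i.+1
      (fun nu => W p nu j l) (fun nu => L nu j).
    rewrite Zdef //; apply: eq_bigr => nu _.
    by have -> : (j == j0 + 1) = false by lia.
  (* Limited or not, the stage is bounded by its unlimited value. *)
  rewrite mul1r -Zj Wdef //; case: ifP => // _.
  apply: (le_trans (limit_norm_le _ _ _ _ _ _)).
  by have -> : (j <= j0) = false by lia.
have WF nu : (nu < i.+1)%N -> vanishing k F (W p nu).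
  by move=> lti; apply: IH => //; exact: ltnW (leq_trans lti lei).
apply: rk_stage_vanishing => nu lti; first exact: WF.
apply: (Lh_vanishing hx hg hq hqk FF d0 hd lk (WF _ lti)).
- exact: trace_r_vanishing (vanishing_shift Fpred (WF _ lti)).
- exact: trace_l_vanishing (WF _ lti).
- exact: trace_r_vanishing (WF _ lti).
- exact: trace_l_vanishing (vanishing_shift Fsucc (WF _ lti)).
Qed.

End Decay.

Lemma lts_step_telescopes U' :
  lts_step k x f g xi om a b CM dt M j0 U U' ->
  vanishing k ((fun n : nat => - n%:Z) @ \oo) U ->
  vanishing k ((fun n : nat => n%:Z) @ \oo) U ->
  exists (flux : int -> R) (c : R),
    [/\ forall j, width x j * U' j 0%N =
                  width x j * U j 0%N + (flux (j - 1) - flux j),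
        flux (- n%:Z) @[n --> \oo] --> c & flux n%:Z @[n --> \oo] --> c].
Proof.
case=> [V [P [t [Z [W [C [_ coarse [_ fine] correction U'def]]]]]]] UN UP.
have [B HB] := @rk_weights _ a b _ a1.
pose s := stages k.
(* The left trace at [x j] seen by the fine side: at [j0] it is the predicted one. *)
pose left p nu j := if j == j0 then t p nu else trace_r k (W p nu j).
pose coarse_flux nu j := g (trace_r k (V nu j)) (trace_l k (V nu (j + 1))).
pose fine_flux nu p j := g (left p nu j) (trace_l k (W p nu (j + 1))).
(* Flux through [x j] accumulated over the whole step. The interface [j0] falls in the fine branch,
   as the correction uses the fine fluxes there. *)
pose flux j := if j < j0 then dt * \sum_(nu < s) B nu * coarse_flux nu j
  else dt / M%:R * \sum_(p < M) \sum_(nu < s) B nu * fine_flux nu p j.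
exists flux, (dt * \sum_(nu < s) B nu * f 0); split.
- move=> j; rewrite U'def // limit_mean.
  have [ltj|gtj|->] /= := ltgtP j j0.
  + have [V0 VS] := coarse; rewrite (HB dt (fun i => V i j 0%N) _ (fun i lei =>
      VS i j 0%N lei ltj isT)).
    rewrite V0 // mulrDr; congr (_ + _).
    have ltj1 : j - 1 < j0 by lia.
    rewrite /flux ltj ltj1 -mulrBr mulrCA; congr (_ * _).
    rewrite mulr_sumr -sumrB; apply: eq_bigr => nu _.
    by rewrite mulrCA Lh0 // mulrBr /coarse_flux subrK.
  + have [W00 WS0 Zdef Wdef] := fine.
    have stepW p : (p < M)%N ->
        width x j * W p s j 0%N = width x j * W p 0%N j 0%N +
        dt / M%:R * (\sum_(nu < s) B nu * fine_flux nu p (j - 1) -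
                     \sum_(nu < s) B nu * fine_flux nu p j).
      (* Limiting keeps the mean, so in degree 0 the limited stages obey the plain Runge-Kutta
         recursion. *)
      move=> ltp; have rec i : (1 <= i <= s)%N -> W p i j 0%N = Z p i j 0%N.
        move=> lei; rewrite Wdef //; case: ifP => // _; rewrite limit_mean.
        by have -> : (j <= j0) = false by lia.
      rewrite (HB (dt / M%:R) (fun i => W p i j 0%N) _
        (fun i lei => etrans (rec i lei) (Zdef p i j 0%N ltp lei gtj isT))).
      rewrite mulrDr; congr (_ + _); rewrite mulrCA; congr (_ * _).
      rewrite mulr_sumr -sumrB; apply: eq_bigr => nu _.
      rewrite mulrCA Lh0 // mulrBr /fine_flux /left subrK.
      have -> : (j - 1 == j0) = (j == j0 + 1) by lia.
      by have -> : (j == j0) = false by lia.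
    have sumW p : (p < M)%N -> width x j * W p s j 0%N = width x j * U j 0%N +
        dt / M%:R * (\sum_(p' < p.+1)
          (\sum_(nu < s) B nu * fine_flux nu p' (j - 1) -
           \sum_(nu < s) B nu * fine_flux nu p' j)).
      elim: p => [|p IH] ltp; first by rewrite stepW // W00 // big_ord1.
      by rewrite stepW // WS0 // IH ?(ltnW ltp) // [in RHS]big_ord_recr /=
        -addrA -mulrDr.
    have -> : W M.-1 (stages k) j 0%N = W M.-1 s j 0%N by [].
    rewrite sumW ?prednK //; congr (_ + _).
    have [nlt nlt1] : (j < j0) = false /\ (j - 1 < j0) = false by split; lia.
    by rewrite /flux nlt nlt1 -mulrBr sumrB.
  + have [C0 CS] := correction.
    rewrite (HB (dt / M%:R) (fun i => C i 0%N) _ (fun i lei => CS i 0%N lei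
      isT)).
    rewrite C0 // mulrDr; congr (_ + _).
    have ltj1 : j0 - 1 < j0 by lia.
    (* The left flux is the same for all [p]: its [M] copies weighted by [dt / M] make up the coarse
       flux. *)
    have dtM : dt = dt / M%:R * M%:R by rewrite -mulrA mulVf ?mulr1 //
      pnatr_eq0 -lt0n.
    rewrite /flux ltxx ltj1 [X in _ = X * _ - _]dtM -(mulrA _ M%:R) -mulrBr
      mulrCA; congr (_ * _).
    rewrite exchange_big mulr_sumr [M%:R * _]mulr_sumr -sumrB; apply: eq_bigr
      => nu _ /=.
    rewrite -[in RHS]mulr_sumr [LHS]mulrCA [M%:R * _]mulrCA -mulrBr;
      congr (_ * _).
    rewrite mulr_sumr; under eq_bigr => p _ do rewrite Lh0 //.
    rewrite sumrB sumr_const card_ord mulr_natl /coarse_flux subrK;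
      congr (_ - _).
    by apply: eq_bigr => p _; rewrite /fine_flux /left eqxx.
- pose FN := (fun n : nat => - n%:Z) @ \oo.
  have FNlt i : \forall j \near FN, j < i.
    by exists `|i|.+1 => // n /= lti; lia.
  have FNsucc : (fun j => j + 1) @ FN `=>` FN.
    (* The bound [N.+1] keeps [n] positive, so that [n.-1] is a true predecessor and still at least
       [N]. *)
    move=> A [N _ NA]; exists N.+1 => // n /= ltn.
    have -> : - n%:Z + 1 = - n.-1%:Z by lia.
    by apply: NA => /=; lia.
  have FNpred : (fun j => j - 1) @ FN `=>` FN.
    move=> A [N _ NA]; exists N => // n /= len.
    have -> : - n%:Z - 1 = - n.+1%:Z by lia.
    by apply: NA => /=; lia.
  have VF nu : (nu < s)%N -> vanishing k FN (V nu).
    by move=> lts; apply: (coarse_vanishing _ FNsucc FNpred UN (FNlt j0)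
      coarse); exact: ltnW.
  have lim : dt * \sum_(nu < s) B nu * coarse_flux nu j @[j --> FN]
      --> dt * \sum_(nu < s) B nu * f 0.
    apply: cvgMl_tmp; apply: cvg_sum_ord => nu; apply: cvgMl_tmp.
    apply: (flux_vanishing hg); first exact: trace_r_vanishing (VF _ _).
    exact: trace_l_vanishing (vanishing_shift FNsucc (VF _ _)).
  suff: flux j @[j --> FN] --> dt * \sum_(nu < s) B nu * f 0 by [].
  apply: cvg_trans lim; apply: near_eq_cvg; apply: filterS (FNlt j0) => j ltj.
  by rewrite /flux ltj.
- pose FP := (fun n : nat => n%:Z) @ \oo.
  have FPgt i : \forall j \near FP, i < j.
    by exists `|i|.+1 => // n /= lti; lia.
  have FPsucc : (fun j => j + 1) @ FP `=>` FP.
    move=> A [N _ NA]; exists N => // n /= len.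
    have -> : n%:Z + 1 = n.+1%:Z by lia.
    by apply: NA => /=; lia.
  have FPpred : (fun j => j - 1) @ FP `=>` FP.
    move=> A [N _ NA]; exists N.+1 => // n /= ltn.
    have -> : n%:Z - 1 = n.-1%:Z by lia.
    by apply: NA => /=; lia.
  have WF p nu : (p < M)%N -> (nu < s)%N -> vanishing k FP (W p nu).
    by move=> ltp lts; apply: (fine_vanishing _ FPsucc FPpred UP (FPgt _) fine)
      => //; exact: ltnW.
  have lim : dt / M%:R * \sum_(p < M) \sum_(nu < s)
        B nu * g (trace_r k (W p nu j)) (trace_l k (W p nu (j + 1))) @[j --> FP]
      --> dt * \sum_(nu < s) B nu * f 0.
    (* The [M] equal substep limits add up to the limit found at the coarse end. *)
    have -> : dt * \sum_(nu < s) B nu * f 0 =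
        dt / M%:R * \sum_(p < M) \sum_(nu < s) B nu * f 0.
      rewrite sumr_const card_ord; set S := (X in dt * X).
      rewrite -[S *+ M]mulr_natl mulrA divfK //.
      by rewrite pnatr_eq0 -lt0n.
    apply: cvgMl_tmp; apply: cvg_sum_ord => p; apply: cvg_sum_ord => nu.
    apply: cvgMl_tmp; apply: (flux_vanishing hg).
      exact: trace_r_vanishing (WF _ _ _ _).
    exact: trace_l_vanishing (vanishing_shift FPsucc (WF _ _ _ _)).
  suff: flux j @[j --> FP] --> dt * \sum_(nu < s) B nu * f 0 by [].
  apply: cvg_trans lim; apply: near_eq_cvg; apply: filterS (FPgt j0) => j gtj.
  rewrite /flux /fine_flux /left.
  have -> : (j < j0) = false by lia.
  by have -> : (j == j0) = false by lia.
Qed.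

End Step.

(** * Conservation of mass for the limited scheme *)

Theorem theorem4p1 (R : realType) (k : nat) (hk : (1 <= k <= 3)%N)
  (x : int -> R) (hx : partitions_line x)
  (hmax : has_ubound (range (width x)))
  (hmin : exists2 d : R, 0 < d & forall j, d <= width x j)
  (f : R -> R) (g : R -> R -> R) (hg : numerical_flux f g)
  (q : nat) (xi om : 'I_q.+2 -> R) (hq : gauss_lobatto xi om)
  (hqk : (k <= (2 * q).+2)%N)
  (a b : nat -> nat -> R) (hab : ssp_rk k a b)
  (CM : R) (hCM : 0 < CM)
  (T : R) (hT : 0 < T) (N : nat) (hN : (0 < N)%N) (M : nat) (hM : (1 <= M)%N)
  (j0 : nat -> int)
  (u0 : R -> R) (hu0 : locally_integrable setT u0)
  (u : nat -> R -> R) (U : nat -> int -> nat -> R)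
  (hu : forall n, (n <= N)%N -> Vh x k (u n) /\ has_coefs x k (u n) (U n))
  (hinit : forall j l, (l <= k)%N ->
    U 0%N j l = limit k x CM (projection x u0) j l)
  (hstep : forall n, (n < N)%N ->
    lts_step k x f g xi om a b CM (T / N%:R) M (j0 n) (U n) (U n.+1)) :
  forall n, (n < N)%N ->
    \int[@lebesgue_measure R]_y u n.+1 y = \int[@lebesgue_measure R]_y u n y.
Proof.
move=> n ltnN; have [d d0 hd] := hmin.
have [[iv _] vU] := hu _ (ltnW ltnN); have [[iv' _] vU'] := hu _ ltnN.
(* Both $-m$ and $m$ eventually avoid any given cell, so one decay statement serves the two ends. *)
have vanish J : (forall i, \forall m \near \oo, J m != i) ->
    vanishing k (J @ \oo) (U n).
  by move=> hJ l lk; exact: (coefs_vanish hx iv vU d0 hd hJ lk).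
have vanishN : vanishing k ((fun m : nat => - m%:Z) @ \oo) (U n).
  by apply: vanish => i; exists `|i|.+1 => // m /=; lia.
have vanishP : vanishing k ((fun m : nat => m%:Z) @ \oo) (U n).
  by apply: vanish => i; exists `|i|.+1 => // m /=; lia.
have [flux [c [step fluxN fluxP]]] := lts_step_telescopes hx d0 hd hg hq hqk
  hM (ssp_rk_consistent hab) (hstep _ ltnN) vanishN vanishP.
exact: (mass_telescope hx iv vU iv' vU' step fluxN fluxP).
Qed.
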